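(* Let $\mathbb B_\omega=\omega\times\mathbb Q$ with $\langle i_1,q_1\rangle<\langle i_2,q_2\rangle$ iff $i_1=i_2$ and $q_1<_{\mathbb Q}q_2$ (countably many disjoint copies of the rationals). For each $\mathbb R$-embeddable complete linear order $L$ whose least element $0_L$ is non-isolated, there is a maximal chain in $\langle\mathbb P(\mathbb B_\omega)\cup\{\emptyset\},\subset\rangle$ isomorphic to $L$.
   Context: $\mathbb P(\mathbb X)$ is the set of subsets of the domain of $\mathbb X$ whose induced suborder is isomorphic to $\mathbb X$. A linear order is complete if it has a least element $0_L$, a greatest element and no gaps; $0_L$ is non-isolated if it has no immediate successor; $\mathbb R$-embeddable means embeddable into $\langle\mathbb R,<\rangle$.
   Formalization: ''Non-isolated'' is taken to include that L has an element other than 0_L: for the one-point order, whose least element vacuously has no immediate successor, the claim fails because every maximal chain contains both the empty set and B_ω. *)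

(* Defs.v *)
From mathcomp Require Import all_boot all_order all_algebra.
From mathcomp Require Import classical_sets functions reals.

Set Implicit Arguments.
Unset Strict Implicit.
Unset Printing Implicit Defensive.

Import Order.TTheory GRing.Theory Num.Theory.

Local Open Scope classical_set_scope.
Local Open Scope order_scope.

(* Orders are given by their strict relation, and A, B are equipped with the
   induced suborders. *)
Definition order_isomorphic (S T : Type) (A : set S) (ltS : S -> S -> Prop)
    (B : set T) (ltT : T -> T -> Prop) : Prop :=
  exists2 f : S -> T, set_bij A B f &
    forall x y, A x -> A y -> (ltS x y <-> ltT (f x) (f y)).

(* The set P(X) of the subsets of X whose induced suborder is isomorphic to X. *)
Definition copies (X : Type) (ltX : X -> X -> Prop) : set (set X) :=
  [set A | order_isomorphic [set: X] ltX A ltX].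

Definition chain_in (X : Type) (P C : set (set X)) : Prop :=
  C `<=` P /\ total_on C subset.

Definition maximal_chain_in (X : Type) (P C : set (set X)) : Prop :=
  chain_in P C /\ forall D, chain_in P D -> C `<=` D -> D = C.

Definition Bomega : Type := (nat * rat)%type.

Definition Bomega_lt (x y : Bomega) : Prop := x.1 = y.1 /\ (x.2 < y.2)%R.

Section LinearOrder.
Context (d : Order.disp_t) (L : orderType d).

Definition is_least (A : set L) (x : L) : Prop :=
  A x /\ forall y, A y -> x <= y.

Definition is_greatest (A : set L) (x : L) : Prop :=
  A x /\ forall y, A y -> y <= x.

Definition is_cut (A B : set L) : Prop :=
  [/\ A !=set0, B !=set0, A `|` B = [set: L] &
      forall a b, A a -> B b -> a < b].

Definition is_gap (A B : set L) : Prop :=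
  [/\ is_cut A B, ~ (exists x, is_greatest A x) & ~ (exists x, is_least B x)].

Definition complete_order : Prop :=
  [/\ exists x, is_least [set: L] x, exists x, is_greatest [set: L] x &
      forall A B : set L, ~ is_gap A B].

Definition immediate_successor (x y : L) : Prop :=
  x < y /\ ~ (exists z, x < z /\ z < y).

(* Used for the least element only.  The least element of a one-point order is
   an isolated point although it has no immediate successor; the first conjunct
   excludes this degenerate case, as every maximal chain of copies together with
   the empty set has at least two elements. *)
Definition non_isolated (x : L) : Prop :=
  (exists y, x < y) /\ ~ (exists y, immediate_successor x y).

Definition embeddable_in (R : realType) : Prop :=
  exists f : L -> R, {mono f : x y / x < y}.

End LinearOrder.

Arguments complete_order {d} L.
Arguments embeddable_in {d} L R.

(* Main.v *)
(** A set of points of [Bomega] is a copy as soon as it meets infinitely many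
    components and each of its components is dense without endpoints (Cantor).
    Give every point [p] a time [s p] in [L] and let the copy of stage [x] be
    [[set p | s p < x]].  These stages form a maximal chain isomorphic to [L]
    when each [x] with an immediate successor is the time of exactly one point,
    and every other time is taken only by points that would be the maximum of
    their component, so that none of them can be added to the stage and still
    give a copy.

    Such times exist.  [L] has countably many jumps and a countable subset [D]
    meeting every nonempty open interval.  An interval [(u, v)] without jumps is
    exhausted by a component isomorphic to its trace on [D], growing from left to
    right.  The jumps are taken by points that are surrounded by earlier ones.
    If an initial interval of [L] has no jumps, each of the infinitely many
    components that grow along it can later receive one more point.  Otherwise
    the jumps accumulate at the least element, and a sequence of jumps tending
    to it is spread over the points of infinitely many components, whose stages
    are then cofinite. *)

Require Import Defs.
From mathcomp Require Import all_boot all_order all_algebra.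
From mathcomp Require Import boolp classical_sets functions cardinality reals.

Set Implicit Arguments.
Unset Strict Implicit.
Unset Printing Implicit Defensive.

Import Order.TTheory GRing.Theory Num.Theory.

Local Open Scope classical_set_scope.
Local Open Scope order_scope.

(** * Enumerations of countable sets *)

Lemma countable_enumeration (T : Type) (A : set T) :
  countable A -> A !=set0 ->
  exists a : nat -> T, (forall n, A (a n)) /\ forall x, A x -> exists n, a n = x.
Proof.
move=> /countable_injP[e e_inj] [x0 Ax0].
have /choice[a aP] n : exists x, A x /\ forall y, A y -> e y = n -> y = x.
  have [[x Ax <-]|nox] := pselect (exists2 x, A x & e x = n).
    by exists x; split=> // y Ay /e_inj; apply; rewrite inE.
  by exists x0; split=> // y Ay eyn; case: nox; exists y.
exists a; split=> [n|x Ax]; first by case: (aP n).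
by exists (e x); have [_ /(_ x Ax erefl)] := aP (e x).
Qed.

Lemma infinite_countable_bijection (T : Type) (A : set T) :
  countable A -> infinite_set A -> exists f : nat -> T, set_bij [set: nat] A f.
Proof.
elim/Ppointed: T => T in A *.
  by move=> _ /infinite_setN0; rewrite emptyE => -[].
move=> cA /infiniteP iA.
by have /card_set_bijP := Cantor_Bernstein iA cA.
Qed.

(** * Countable dense orders without endpoints and Cantor's theorem *)

Section DenseUnbounded.
Context (d : Order.disp_t) (T : orderType d).
Implicit Types (A : set T) (s l u : seq T).

(* The empty set qualifies. *)
Definition dense_unbounded A : Prop :=
  [/\ forall x, A x -> exists2 y, A y & y < x,
      forall x, A x -> exists2 y, A y & x < y &
      forall x y, A x -> A y -> x < y -> exists z, [/\ A z, x < z & z < y]].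

Lemma seq_has_max s : s <> [::] -> exists2 m, m \in s & {in s, forall x, x <= m}.
Proof.
elim: s => // x [|y s] IH _.
  by exists x; rewrite ?mem_head // => z; rewrite inE => /eqP->.
have [//|m ms mmax] := IH; have [xm|mx] := leP x m.
  exists m; first by rewrite inE ms orbT.
  by move=> z; rewrite inE => /predU1P[->|/mmax].
exists x; first by rewrite mem_head.
move=> z; rewrite inE => /predU1P[->//|/mmax zm].
exact: le_trans zm (ltW mx).
Qed.

Lemma seq_has_min s : s <> [::] -> exists2 m, m \in s & {in s, forall x, m <= x}.
Proof.
elim: s => // x [|y s] IH _.
  by exists x; rewrite ?mem_head // => z; rewrite inE => /eqP->.
have [//|m ms mmin] := IH; have [mx|xm] := leP m x.
  exists m; first by rewrite inE ms orbT.
  by move=> z; rewrite inE => /predU1P[->|/mmin].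
exists x; first by rewrite mem_head.
move=> z; rewrite inE => /predU1P[->//|/mmin mz].
exact: le_trans (ltW xm) mz.
Qed.

Lemma dense_unbounded_between A l u :
  dense_unbounded A -> A !=set0 ->
  {in l, forall x, A x} -> {in u, forall x, A x} ->
  {in l & u, forall x y, x < y} ->
  exists z, [/\ A z, {in l, forall x, x < z} & {in u, forall y, z < y}].
Proof.
move=> [Anomin Anomax Adense] [a Aa] lA uA lu.
have [->|/eqP/seq_has_max[m ml mmax]] := eqVneq l [::];
have [->|/eqP/seq_has_min[m' mu mmin]] := eqVneq u [::].
- by exists a.
- have [y Ay ym] := Anomin _ (uA _ mu).
  by exists y; split=> // x /mmin; apply: lt_le_trans.
- have [y Ay ym] := Anomax _ (lA _ ml).
  by exists y; split=> // x /mmax xm; apply: le_lt_trans xm ym.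
- have [z [Az mz zm]] := Adense _ _ (lA _ ml) (uA _ mu) (lu _ _ ml mu).
  exists z; split=> // x; first by move=> /mmax xm; apply: le_lt_trans xm mz.
  by move=> /mmin; apply: lt_le_trans.
Qed.

End DenseUnbounded.

Section PartialIsomorphism.
Context (d1 d2 : Order.disp_t) (S : orderType d1) (T : orderType d2).
Context (A : set S) (B : set T).

Definition partial_iso (s : seq (S * T)) : Prop :=
  {in s, forall p, A p.1 /\ B p.2} /\
  {in s &, forall p q, (p.1 < q.1) = (p.2 < q.2)}.

(** The image of [a] has to separate the images of the points below [a] from those of the points
    above. Both sets are finite, so [B] has room between them. A point already in the domain keeps
    its image. *)
Lemma partial_iso_extend s a :
  dense_unbounded B -> B !=set0 -> partial_iso s -> A a ->
  exists b, partial_iso ((a, b) :: s).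
Proof.
move=> duB B0 [sAB sM] Aa.
have [[b abs]|nodom] := pselect (exists b, (a, b) \in s).
  exists b; split=> [p|p q].
    by rewrite inE => /predU1P[->|]; apply: sAB.
  by rewrite !inE => /predU1P[->|ps] /predU1P[->|qs]; apply: sM.
pose l := [seq p.2 | p <- s & p.1 < a]; pose u := [seq p.2 | p <- s & a < p.1].
have [||x y|b [Bb lb bu]] := @dense_unbounded_between _ T B l u duB B0.
- by move=> z /mapP[p]; rewrite mem_filter => /andP[_ /sAB[_ ?]] ->.
- by move=> z /mapP[p]; rewrite mem_filter => /andP[_ /sAB[_ ?]] ->.
- move=> /mapP[p]; rewrite mem_filter => /andP[pa ps ->].
  move=> /mapP[q]; rewrite mem_filter => /andP[aq qs ->].
  by rewrite -sM // (lt_trans pa aq).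
have cmpb p : p \in s -> ((p.1 < a) = (p.2 < b)) * ((a < p.1) = (b < p.2)).
  move=> ps; case: (ltgtP p.1 a) => pa.
  - have pb : p.2 < b by apply/lb/mapP; exists p => //; rewrite mem_filter pa.
    by rewrite pb ltNge (ltW pb).
  - have pb : b < p.2 by apply/bu/mapP; exists p => //; rewrite mem_filter pa.
    by rewrite pb ltNge (ltW pb).
  - by case: nodom; exists p.2; rewrite -pa -surjective_pairing.
exists b; split=> [p|p q].
  by rewrite inE => /predU1P[->|/sAB].
rewrite !inE => /predU1P[->|ps] /predU1P[->|qs] /=; rewrite ?ltxx ?cmpb //.
exact: sM.
Qed.

End PartialIsomorphism.

Lemma partial_iso_swap (d1 d2 : Order.disp_t) (S : orderType d1)
    (T : orderType d2) (A : set S) (B : set T) (s : seq (S * T)) :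
  partial_iso A B s -> partial_iso B A [seq (p.2, p.1) | p <- s].
Proof.
move=> [sAB sM]; split=> [_ /mapP[p /sAB[? ?] ->] //|].
by move=> _ _ /mapP[p ps ->] /mapP[q qs ->] /=; rewrite sM.
Qed.

Section Cantor.
Context (d1 d2 : Order.disp_t) (S : orderType d1) (T : orderType d2).
Context (A : set S) (B : set T).
Hypotheses (A_countable : countable A) (B_countable : countable B).
Hypotheses (A_nonempty : A !=set0) (B_nonempty : B !=set0).
Hypotheses (duA : dense_unbounded A) (duB : dense_unbounded B).

(** Back and forth: passing from [s k] to [s k.+1] puts [a k] into the domain and [b k] into the
    range. The union [r] of these finite partial isomorphisms is the graph of an isomorphism. *)
Lemma cantor_isomorphism :
  order_isomorphic A (fun x y => x < y) B (fun x y => x < y).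
Proof.
have [a [aA a_onto]] := countable_enumeration A_countable A_nonempty.
have [b [bB b_onto]] := countable_enumeration B_countable B_nonempty.
(* [F] picks a preimage of [b n], and [G] below an image of [a n]; their values are arbitrary where
   the list is not a partial isomorphism. *)
have /choice[F FP] (sn : seq (S * T) * nat) : exists x y,
    partial_iso A B sn.1 ->
    partial_iso A B ((x, b sn.2) :: (a sn.2, y) :: sn.1).
  have [s_iso|nots] := pselect (partial_iso A B sn.1); last first.
    by exists (a 0), (b 0) => /nots.
  have [y y_iso] := partial_iso_extend duB B_nonempty s_iso (aA sn.2).
  have [x x_iso] := partial_iso_extend duA A_nonempty
    (partial_iso_swap y_iso) (bB sn.2).
  exists x, y => _; move: (partial_iso_swap x_iso) => /=; rewrite -map_comp.
  rewrite (@eq_map _ _ _ id) ?map_id // => p.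
  by rewrite /= -surjective_pairing.
have {FP}[G GP] := choice FP.
pose s := fix s n := if n is k.+1 then
  (F (s k, k), b k) :: (a k, G (s k, k)) :: s k else [::].
have s_iso n : partial_iso A B (s n) by elim: n => [//|n IH]; apply: (GP (_, _)).
have s_sub m n : (m <= n)%N -> {subset s m <= s n}.
  elim: n => [|n IH]; first by rewrite leqn0 => /eqP->.
  rewrite leq_eqVlt ltnS => /predU1P[->//|/IH sub p /sub ps].
  by rewrite /= !inE ps !orbT.
pose r x y := exists n, (x, y) \in s n.
have rM x y x' y' : r x y -> r x' y' -> (x < x') = (y < y').
  move=> [m xys] [n xys']; have [_ /(_ (x, y) (x', y'))] := s_iso (maxn m n).
  by apply; [apply: s_sub xys|apply: s_sub xys']; rewrite ?leq_maxl ?leq_maxr.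
have rAB x y : r x y -> A x /\ B y.
  by move=> [n xys]; have [/(_ (x, y) xys)] := s_iso n.
have r_dom x : A x -> exists y, r x y.
  move=> /a_onto[n <-]; exists (G (s n, n)), n.+1.
  by rewrite /= !inE eqxx orbT.
have r_codom y : B y -> exists x, r x y.
  by move=> /b_onto[n <-]; exists (F (s n, n)), n.+1; rewrite /= mem_head.
have /choice[f fP] x : exists y, A x -> r x y.
  have [/r_dom[y rxy]|nAx] := pselect (A x); first by exists y.
  by exists (b 0) => /nAx.
have fM x y : A x -> A y -> (x < y) = (f x < f y).
  by move=> /fP rx /fP ry; apply: rM.
exists f => [|x y Ax Ay]; last by rewrite fM.
split=> [x Ax|x y|y By].
- by have [] := rAB _ _ (fP _ Ax).
- rewrite !inE => Ax Ay fxy.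
  by case: (ltgtP x y) => //; rewrite fM // fxy ltxx.
- have [x rxy] := r_codom _ By; have [Ax _] := rAB _ _ rxy.
  exists x => //; have rxfx := fP _ Ax.
  case: (ltgtP (f x) y) => //.
    by rewrite -(rM _ _ _ _ rxfx rxy) ltxx.
  by rewrite -(rM _ _ _ _ rxy rxfx) ltxx.
Qed.

End Cantor.

(** * Recognizing copies of [Bomega] *)

Lemma dense_unbounded_rat : dense_unbounded [set: rat].
Proof.
split=> [x _|x _|x y _ _ xy].
- by exists (x - 1)%R => //; rewrite ltrBlDr ltrDl.
- by exists (x + 1)%R => //; rewrite ltrDl.
- exists ((x + y) / 2%:R)%R.
  by have [? ?] := midf_lt xy; split.
Qed.

(** The nonempty components are infinitely many, hence indexed bijectively by [nat] through [k], and
    Cantor's theorem matches each of them with the rationals. *)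
Lemma copies_Bomega (A : set Bomega) :
  (forall n, exists2 p, A p & (n <= p.1)%N) ->
  (forall n, dense_unbounded [set q | A (n, q)]) ->
  copies Bomega_lt A.
Proof.
move=> A_inf A_du; pose K := [set n | [set q | A (n, q)] !=set0].
have K_inf : infinite_set K.
  move=> /finite_setP[m /card_esym/card_set_bijP[f [_ _ f_onto]]].
  (* A finite [K] would be bounded by the maximum of its enumeration [f]. *)
  have [[n q] Anq] := A_inf (\max_(i < m) f i).+1.
  have [|i /= im <-] := f_onto n; first by exists q.
  by rewrite ltnNge (leq_bigmax (Ordinal im)).
have [k [kK k_inj k_onto]] := infinite_countable_bijection (countableP K) K_inf.
have /choice[g gP] i : exists g : rat -> rat,
    set_bij [set: rat] [set q | A (k i, q)] g /\
    forall x y, ((x < y) <-> (g x < g y))%R.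
  have [||g g_bij gM] := @cantor_isomorphism _ _ _ _ [set: rat]
    [set q | A (k i, q)] (countableP _) (countableP _) _ _ dense_unbounded_rat
    (A_du _).
  - by exists 0%R.
  - exact: kK.
  - by exists g; split=> // x y; apply: gM.
exists (fun p => (k p.1, g p.1 p.2)).
  split=> [[i q] _ /=|[i q] [j q'] _ _ /= [kij]|[n q] Anq].
  - by have [[+ _ _] _] := gP i; apply.
  - have ij : i = j by apply: k_inj kij; rewrite inE.
    rewrite ij => gqq'; congr pair.
    by have [[_ + _] _] := gP j; apply => //; rewrite inE.
  - have [|i _ kin] := k_onto n; first by exists q.
    rewrite -kin in Anq *.
    have [[_ _ /(_ _ Anq)[q' _ gq']] _] := gP i.
    by exists (i, q') => //=; rewrite gq'.
move=> [i q] [j q'] _ _; split=> -[/= ij lt].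
  by rewrite /Bomega_lt /= -ij; split=> //; rewrite -(gP i).2.
have {}ij : i = j by apply: k_inj ij; rewrite inE.
by split=> //=; rewrite (gP i).2; rewrite -ij in lt.
Qed.

(** * Jumps and schedules *)

Definition jump (d : Order.disp_t) (L : orderType d) (x : L) : Prop :=
  exists y, immediate_successor x y.

(** Half-open, because the points that enter between the stages [x] and [y] are those with times in
    [[x, y)]. *)
Definition jump_free (d : Order.disp_t) (L : orderType d) (x y : L) : Prop :=
  forall z, x <= z -> z < y -> ~ jump z.

(* [s p] is the time just after which the point [p] enters the growing family
   of copies [[set p | s p < x]]. *)
Record schedule (d : Order.disp_t) (L : orderType d) (s : Bomega -> L) : Prop :=
  Schedule {
  schedule_not_last : forall p, exists y, s p < y;
  schedule_jump_onto : forall x, jump x -> exists p, s p = x;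
  schedule_jump_inj : forall p p', jump (s p) -> s p = s p' -> p = p';
  schedule_increasing : forall n (q q' : rat),
    ~ jump (s (n, q)) -> (q < q')%R -> s (n, q) < s (n, q');
  schedule_dense : forall x y, x < y -> jump_free x y ->
    exists2 p, x <= s p & s p < y;
  schedule_infinite : forall x y n, x < y ->
    exists2 p, s p < y & (n <= p.1)%N;
  schedule_dense_unbounded : forall n x,
    dense_unbounded [set q | s (n, q) < x] }.

(** * The maximal chain of stages given by a schedule *)

Section ScheduleChain.
Context (d : Order.disp_t) (L : orderType d) (zero : L).
Hypotheses (L_complete : complete_order L) (zero_least : is_least [set: L] zero).
Context (s : Bomega -> L) (s_schedule : schedule s).

Definition stage (x : L) : set Bomega := [set p | s p < x].

(** If [y < x], some point has its time in [[y, x)]: it takes a jump lying there or, when there is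
    none, comes from [schedule_dense]. *)
Lemma stage_subset x y : stage x `<=` stage y <-> x <= y.
Proof.
split=> [sub|xy p sp]; last exact: lt_le_trans sp xy.
rewrite leNgt; apply/negP => yx.
have [p yp px] : exists2 p, y <= s p & s p < x.
  have [[z [yz zx zj]]|nojump] :=
      pselect (exists z, [/\ y <= z, z < x & jump z]).
    by have [p pz] := schedule_jump_onto s_schedule zj; exists p; rewrite pz.
  apply: (schedule_dense s_schedule) => // z yz zx zj.
  by apply: nojump; exists z.
by have := sub p px; rewrite /stage /= ltNge yp.
Qed.

Lemma stage_zero : stage zero = set0.
Proof.
apply/seteqP; split=> // p; rewrite /stage /= ltNge.
by rewrite (zero_least.2 _ I).
Qed.

Lemma stage_copy x : zero < x -> copies Bomega_lt (stage x).
Proof.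
move=> x0; apply: copies_Bomega => [n|n].
  exact: (schedule_infinite s_schedule n x0).
exact: (schedule_dense_unbounded s_schedule).
Qed.

(** This yields maximality of the chain. Take the largest [x] whose stage lies in [D]; comparability
    bounds all times in [D] by [x]. A point of [D] with time exactly [x] is impossible: if [x] is no
    jump, a higher point of [D] in the same component would have a later time; if [x] is a jump, the
    stage of its successor would lie in [D] too. *)
Lemma comparable_copy_is_stage (D : set Bomega) :
  (copies Bomega_lt `|` [set set0]) D ->
  (forall x, D `<=` stage x \/ stage x `<=` D) -> exists x, stage x = D.
Proof.
move=> PD cmpD; pose U := [set x | stage x `<=` D].
have U_zero : U zero by rewrite /U /= stage_zero.
have U_down x y : U y -> x <= y -> U x.
  by move=> Uy /stage_subset sub; apply: subset_trans sub Uy.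
(* A point with time below [v] already belongs to the stage of some member of [U], so [U] is closed
   under such limits. *)
have U_nomax v : (forall x, x < v -> exists2 y, U y & x < y) -> U v.
  by move=> Uv p /Uv[y Uy sy]; apply: Uy.
have [x Ux Umax] : exists2 x, U x & forall y, U y -> y <= x.
  have [_ [m [_ mmax]] nogap] := L_complete.
  have [[v nUv]|UT] := pselect (exists v, ~ U v); last first.
    by exists m => [|y _]; [apply: contrapT => nUm; apply: UT; exists m|exact: mmax].
  (* Without a largest element, [U] and its complement form a gap: a least element of the complement
     would be a limit of [U]. *)
  apply: contrapT => noUmax; apply: (nogap U (setC U)); split.
  - split; [by exists zero|by exists v|by rewrite joinEset setUv|].
    move=> a b Ua nUb; rewrite ltNge; apply/negP => ba.
    exact: nUb (U_down _ _ Ua ba).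
  - by move=> [x [Ux Umax]]; apply: noUmax; exists x.
  - move=> [w [nUw wmin]]; apply: nUw; apply: U_nomax => x xw.
    have Ux : U x.
      by apply: contrapT => /wmin; rewrite leNgt xw.
    apply: contrapT => noy; apply: noUmax; exists x => // y Uy.
    by rewrite leNgt; apply/negP => xy; apply: noy; exists y.
exists x; have D_le p : D p -> s p <= x.
  move=> Dp; rewrite leNgt; apply/negP => xp.
  have [/(_ p Dp)|/Umax] := cmpD (s p); first by rewrite /stage /= ltxx.
  by rewrite leNgt xp.
apply/seteqP; split=> // p Dp.
have := D_le p Dp; rewrite le_eqVlt => /predU1P[px|//].
have [xj|xnj] := pselect (jump x); last first.
  case: PD => [[f [fD f_inj f_onto] fM]|D0]; last by rewrite D0 in Dp.
  have [[i q] _ fiq] := f_onto p Dp.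
  (* A copy has no maximal point, so [D] contains a point above [p] in the component of [p]. *)
  have [r qr] : exists r, (q < r)%R.
    by have [_ /(_ q I)[r _ qr] _] := dense_unbounded_rat; exists r.
  have : Bomega_lt (i, q) (i, r) by [].
  rewrite fM // fiq => -[].
  have Dr : D (f (i, r)) by apply: fD.
  move: (f (i, r)) Dr p {Dp fiq} px => [n' r'] Dr [n q'] /= px nn qr'.
  rewrite -nn in Dr; rewrite -px in xnj.
  have := schedule_increasing s_schedule xnj qr'.
  by rewrite px ltNge D_le.
have [y [xy ynext]] := xj.
(* No time lies strictly between [x] and [y], so the stage of [y] adds only points of time [x], and
   [p] is the only one. *)
have Uy : U y.
  move=> p' p'y; have [/Ux//|xp'] := ltP (s p') x.
  have p'x : s p' = x.
    apply/eqP; rewrite eq_le xp' andbT leNgt; apply/negP => xp.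
    by apply: ynext; exists (s p').
  by rewrite (@schedule_jump_inj _ _ _ s_schedule p' p) // p'x.
by have := Umax _ Uy; rewrite leNgt xy.
Qed.

Lemma schedule_chain :
  exists C : set (set Bomega),
    maximal_chain_in (copies Bomega_lt `|` [set set0]) C /\
    order_isomorphic C (fun A B => A `<` B) [set: L] (fun x y => x < y).
Proof.
have stage_inj x y : stage x = stage y -> x = y.
  by move=> xy; apply/le_anti/andP; split; apply/stage_subset; rewrite xy.
have stage_total x y : stage x `<=` stage y \/ stage y `<=` stage x.
  by case: (leP x y) => [|/ltW] /stage_subset; [left|right].
exists (range stage); split.
  split.
    split=> [_ [x _ <-]|_ _ [x _ <-] [y _ <-]]; last exact: stage_total.
    have := zero_least.2 x I; rewrite le_eqVlt => /predU1P[<-|/stage_copy].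
      by right; rewrite stage_zero.
    by left.
  move=> D [DP D_total] CD; apply/seteqP; split=> // B DB.
  have [||x <-] := @comparable_copy_is_stage B; [exact: DP| |by exists x].
  by move=> x; apply: D_total => //; apply: CD; exists x.
(* The isomorphism is the inverse of [stage], with the default [zero] off the chain. *)
have /choice[h hP] B : exists x, range stage B -> stage x = B.
  have [[x _ <-]|nB] := pselect (range stage B); first by exists x.
  by exists zero => /nB.
have hK x : h (stage x) = x by apply/stage_inj/hP; exists x.
exists h.
  split=> // [_ _ /set_mem[x _ <-] /set_mem[y _ <-]|x _].
    by rewrite !hK => ->.
  by exists (stage x) => //; exists x.
move=> _ _ [x _ <-] [y _ <-]; rewrite !hK properEneq; split.
  case=> /eqP neq /stage_subset; rewrite le_eqVlt => /predU1P[xy|//].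
  by case: neq; rewrite xy.
move=> xy; split; last exact/stage_subset/ltW.
by apply/eqP => /stage_inj xy'; rewrite xy' ltxx in xy.
Qed.

End ScheduleChain.

(** * Countability consequences of embeddability into the reals *)

Section Embeddable.
Context (R : realType) (d : Order.disp_t) (L : orderType d).
Hypothesis L_embeddable : embeddable_in L R.

(** [D] takes one point from the preimage of each rational interval whose preimage is nonempty.
    Rationals on both sides of [f z], between [f x] and [f y], bound such an interval. *)
Lemma embeddable_countable_dense : exists D : set L, countable D /\
  forall x z y, x < z -> z < y -> exists c, [/\ D c, x < c & c < y].
Proof.
have [f fM] := L_embeddable.
pose inside (r : rat * rat) c := (ratr r.1 < f c)%R /\ (f c < ratr r.2)%R.
have /choice[g gP] r : exists o : option L, forall c, inside r c ->
    exists2 c', o = Some c' & inside r c'.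
  have [[c cr]|noc] := pselect (exists c, inside r c).
    by exists (Some c) => _ _; exists c.
  by exists None => c cr; case: noc; exists c.
exists [set c | range g (Some c)]; split.
  have [e e_inj] := countable_injP _ (countableP [set: rat * rat]).
  have /choice[k kP] c : exists r, range g (Some c) -> g r = Some c.
    have [[r _ rc]|noc] := pselect (range g (Some c)); first by exists r.
    by exists (0%R, 0%R) => /noc.
  apply/countable_injP; exists (e \o k) => c c'.
  rewrite !inE => /kP kc /kP kc' /= /e_inj; rewrite !inE => /(_ I I) kk.
  by apply: Some_inj; rewrite -kc -kc' kk.
move=> x z y; rewrite -!fM => /rat_in_itvoo[r1 r1P] /rat_in_itvoo[r2].
move: r1P; rewrite !in_itv /= => /andP[xr1 r1z] /andP[zr2 r2y].
have [|c rc [r1c cr2]] := gP (r1, r2) z; first by [].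
exists c; split; first by exists (r1, r2).
  by rewrite -fM (lt_trans xr1).
by rewrite -fM (lt_trans cr2).
Qed.

(** A rational between the images of a jump and its successor determines the jump, since the real
    intervals spanned by different jumps are disjoint. *)
Lemma embeddable_countable_jump : countable [set x : L | jump x].
Proof.
have [f fM] := L_embeddable.
have /choice[k kP] x : exists r : rat, forall y, immediate_successor x y ->
    (f x < ratr r)%R /\ (ratr r < f y)%R.
  have [[y [xy ynext]]|noy] := pselect (jump x); last first.
    by exists 0%R => y xy; case: noy; exists y.
  have := xy; rewrite -fM => /rat_in_itvoo[r]; rewrite in_itv /= => /andP[xr ry].
  exists r => z [xz znext]; suff -> : z = y by [].
  by case: (ltgtP z y) => // zy; [case: ynext; exists z|case: znext; exists y].
apply/(sub_countable _ (countableP [set: rat]))/pcard_injP; exists k => x x'.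
rewrite !inE => -[y xy] [y' xy'] kk.
have [xk ky] := kP _ _ xy; have [xk' ky'] := kP _ _ xy'.
rewrite kk in xk ky; case: xy xy' => _ nxy [_ nxy'].
have x'y : x' < y by rewrite -fM (lt_trans xk').
have xy' : x < y' by rewrite -fM (lt_trans xk).
by case: (ltgtP x x') => // xx; [case: nxy; exists x'|case: nxy'; exists x].
Qed.

End Embeddable.

(** * Components growing along jump-free intervals *)

Section IntervalComponent.
Context (d : Order.disp_t) (L : orderType d) (D : set L).
Hypothesis D_countable : countable D.
Hypothesis D_dense :
  forall x z y, x < z -> z < y -> exists c, [/\ D c, x < c & c < y].

(** [A] is a parameter so that a point of the component can be held back for a later time. *)
Definition interval_component (A : set rat) (u v : L) (g : rat -> L) : Prop :=
  [/\ forall q, A q -> u < g q /\ g q < v,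
      forall q q', A q -> A q' -> (q < q')%R -> g q < g q' &
      forall x y, u <= x -> x < y -> y <= v -> exists q, [/\ A q, x < g q & g q < y]].

(** An empty interval between [x] and [y] would make [x] a jump. *)
Lemma jump_free_dense u v x y : jump_free u v -> u <= x -> x < y -> y <= v ->
  exists c, [/\ D c, x < c & c < y].
Proof.
move=> uv ux xy yv; have [[z [xz zy]]|noz] := pselect (exists z, x < z /\ z < y).
  exact: D_dense xz zy.
by case: (uv x ux (lt_le_trans xy yv)); exists y.
Qed.

(** Cantor's theorem maps [A] onto the trace of [D] on the open interval from [u] to [v]. *)
Lemma interval_component_exists (A : set rat) u v :
  dense_unbounded A -> A !=set0 -> u < v -> jump_free u v ->
  exists g, interval_component A u v g.
Proof.
move=> duA A0 uv uvj; pose B := [set c | [/\ D c, u < c & c < v]].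
have uv_dense := jump_free_dense uvj.
have B_countable : countable B.
  by apply: sub_countable D_countable; apply: subset_card_le => c [].
have B_nonempty : B !=set0 by exact: uv_dense.
have duB : dense_unbounded B.
  split=> [x [Dx ux xv]|x [Dx ux xv]|x y [Dx ux xv] [Dy uy yv] xy].
  - have [c [Dc uc cx]] := uv_dense _ _ (lexx u) ux (ltW xv).
    by exists c => //; split=> //; apply: lt_trans cx xv.
  - have [c [Dc xc cv]] := uv_dense _ _ (ltW ux) xv (lexx v).
    by exists c => //; split=> //; apply: lt_trans ux xc.
  - have [c [Dc xc cy]] := uv_dense _ _ (ltW ux) xy (ltW yv).
    exists c; split=> //; split=> //; first exact: lt_trans ux xc.
    exact: lt_trans cy yv.
have [g [gB _ g_onto] gM] := cantor_isomorphism (countableP A) B_countable A0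
  B_nonempty duA duB.
exists g; split=> [q /gB[]//|q q' Aq Aq' qq'|x y ux xy yv].
  by rewrite -gM.
have [c [Dc xc cy]] := uv_dense _ _ ux xy yv.
have [|q Aq gq] := g_onto c.
  by split=> //; [exact: le_lt_trans ux xc|exact: lt_le_trans cy yv].
by exists q; rewrite gq.
Qed.

Lemma interval_component_dense_unbounded (A : set rat) u v g x :
  dense_unbounded A -> interval_component A u v g ->
  dense_unbounded [set q | A q /\ g q < x].
Proof.
move=> [Anomin _ Adense] [gB gM gdense].
split=> [q [Aq qx]|q [Aq qx]|q r [Aq qx] [Ar rx] qr].
- have [r Ar rq] := Anomin _ Aq; exists r => //.
  by split=> //; apply: lt_trans qx; apply: gM.
- have [uq qv] := gB _ Aq.
  (* The density of [g] is available only up to [v], hence the minimum. *)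
  have [||r [Ar qr rxv]] := gdense (g q) (Order.min x v) (ltW uq).
  + by rewrite lt_min qx qv.
  + by rewrite ge_min lexx orbT.
  move: rxv; rewrite lt_min => /andP[rx rv]; exists r => //.
  rewrite ltNge; apply/negP; rewrite le_eqVlt => /predU1P[rq|rq].
    by rewrite rq ltxx in qr.
  by have := gM _ _ Ar Aq rq; rewrite ltNge (ltW qr).
- have [c [Ac qc cr]] := Adense _ _ Aq Ar qr.
  exists c; split=> //; split=> //.
  by apply: lt_trans rx; apply: gM.
Qed.

End IntervalComponent.

(** * Cofinite sets of rationals *)

Lemma rat_avoid (t : seq rat) (a b : rat) :
  (a < b)%R -> exists c, [/\ c \notin t, (a < c)%R & (c < b)%R].
Proof.
elim: t b => [|x t IH] b ab.
  by have [_ _ /(_ a b I I ab)[c [_ ac cb]]] := dense_unbounded_rat; exists c.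
have [c [ct ac cb]] := IH b ab; have [cx|ncx] := eqVneq c x.
  have [e [et ae ec]] := IH c ac; exists e; split=> //.
    by rewrite inE negb_or et andbT -cx lt_eqF.
  exact: lt_trans ec cb.
by exists c; rewrite inE negb_or ncx.
Qed.

Lemma cofinite_dense_unbounded (A : set rat) (t : seq rat) :
  (forall q, q \notin t -> A q) -> dense_unbounded A.
Proof.
move=> At; have [nomin nomax _] := dense_unbounded_rat.
split=> [q _|q _|q r _ _ qr].
- have [r _ rq] := nomin q I; have [c [ct _ cq]] := rat_avoid t rq.
  by exists c => //; apply: At.
- have [r _ qr] := nomax q I; have [c [ct qc _]] := rat_avoid t qr.
  by exists c => //; apply: At.
- have [c [ct qc cr]] := rat_avoid t qr.
  by exists c; split=> //; apply: At.
Qed.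

(** * Existence of a schedule *)

Section ScheduleExists.
Context (d : Order.disp_t) (L : orderType d) (zero : L) (D : set L).
Hypothesis zero_least : is_least [set: L] zero.
Hypothesis zero_non_isolated : non_isolated zero.
Hypothesis jump_countable : countable [set x : L | jump x].
Hypothesis D_countable : countable D.
Hypothesis D_dense :
  forall x z y, x < z -> z < y -> exists c, [/\ D c, x < c & c < y].

(** Endpoints in [D] keep these intervals countable in number, while every nonempty jump-free
    interval still contains one. *)
Definition free_interval : set (L * L) :=
  [set uv | [/\ D uv.1, D uv.2, uv.1 < uv.2 & jump_free uv.1 uv.2]].

Lemma free_interval_countable : countable free_interval.
Proof.
apply: sub_countable (countableX D_countable D_countable).
by apply: subset_card_le => uv [].
Qed.

Lemma free_interval_between (x y : L) : x < y -> jump_free x y ->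
  exists2 uv, free_interval uv & x < uv.1 /\ uv.2 < y.
Proof.
move=> xy xyj; have [u [Du xu uy]] := jump_free_dense D_dense xyj (lexx x) xy (lexx y).
have [v [Dv uv vy]] := jump_free_dense D_dense xyj (ltW xu) uy (lexx y).
exists (u, v) => //; split=> // z uz zv; apply: xyj.
  exact: le_trans (ltW xu) uz.
exact: lt_trans zv vy.
Qed.

Lemma free_interval_component uv : free_interval uv ->
  exists g, interval_component [set: rat] uv.1 uv.2 g.
Proof.
move=> [_ _ uv1 uvj].
apply: (interval_component_exists D_countable D_dense) => //.
  exact: dense_unbounded_rat.
by exists 0%R.
Qed.

Lemma interval_component_schedule (u v : L) (g : rat -> L) : jump_free u v ->
  interval_component [set: rat] u v g ->
  [/\ forall q, exists y, g q < y, forall q, ~ jump (g q),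
      forall q q' : rat, (q < q')%R -> g q < g q' &
      forall x, dense_unbounded [set q | g q < x]].
Proof.
move=> uvj gP; have [gB gM _] := gP; split=> [q|q|q q'|x].
- by exists v; have [] := gB q I.
- by have [/ltW uq qv] := gB q I; apply: uvj.
- exact: gM.
- rewrite (_ : [set q | g q < x] = [set q | [set: rat] q /\ g q < x]).
    exact: interval_component_dense_unbounded dense_unbounded_rat gP.
  by apply/seteqP; split=> q //= -[].
Qed.

(* A component growing along a free interval [[zero, b)], with its point [0]
   held back until the jump [j]. *)
Lemma punctured_component b j : zero < b -> jump_free zero b -> jump j ->
  exists c : rat -> L,
  [/\ c 0%R = j,
      forall q, q != 0%R -> exists2 y, c q < y & ~ jump (c q),
      forall q q' : rat, q != 0%R -> (q < q')%R -> c q < c q',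
      forall x, dense_unbounded [set q | c q < x] &
      forall x, zero < x -> exists q, c q < x].
Proof.
move=> b0 bj jj; pose A := [set q : rat | q != 0%R].
have duA : dense_unbounded A.
  by apply: (@cofinite_dense_unbounded _ [:: 0%R]) => q; rewrite inE.
have [|g gP] := interval_component_exists D_countable D_dense duA _ b0 bj.
  by exists 1%R.
have [gB gM gdense] := gP.
(* There is no jump before [b], so the point [0] enters after all the others. *)
have b_le_j : b <= j.
  by rewrite leNgt; apply/negP => jb; apply: (bj j) => //; apply: (zero_least.2 j I).
pose c q := if q == 0%R then j else g q.
have cE q : A q -> c q = g q by rewrite /A /c /= => /negbTE->.
exists c; split=> [|q q0|q q' q0 qq'|x|x x0].
- by rewrite /c eqxx.
- have [zq qb] := gB q q0; rewrite cE //.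
  by exists b => //; apply: bj => //; apply: ltW.
- rewrite (cE q) //; have [q'0|q'0] := eqVneq q' 0%R; last first.
    by rewrite cE //; apply: gM.
  rewrite q'0 /c eqxx; apply: lt_le_trans b_le_j.
  by have [] := gB q q0.
(* Past [j] the component is complete; until then only its punctured part counts. *)
- have [jx|xj] := ltP j x.
    rewrite (_ : [set q | c q < x] = [set: rat]); first exact: dense_unbounded_rat.
    apply/seteqP; split=> // q _ /=; have [->|q0] := eqVneq q 0%R.
      by rewrite /c eqxx.
    rewrite cE //; apply: lt_trans jx; apply: lt_le_trans b_le_j.
    by have [] := gB q q0.
  rewrite (_ : [set q | c q < x] = [set q | A q /\ g q < x]).
    exact: interval_component_dense_unbounded duA gP.
  apply/seteqP; split=> q /=; last by case=> Aq; rewrite cE.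
  have [->|q0] := eqVneq q 0%R; first by rewrite /c eqxx ltNge xj.
  by rewrite cE // => qx; split.
- have [||q [Aq _ qx]] := gdense zero (Order.min x b) (lexx _).
  + by rewrite lt_min x0 b0.
  + by rewrite ge_min lexx orbT.
  by exists q; rewrite cE //; move: qx; rewrite lt_min => /andP[].
Qed.

(** The even components all start growing at [zero], so every nonempty stage meets infinitely many
    components, and each of them can still receive one jump at its point [0]. *)
Lemma schedule_of_free_interval b :
  zero < b -> jump_free zero b -> exists s : Bomega -> L, schedule s.
Proof.
move=> b0 bj.
have [e e_inj] := countable_injP _ jump_countable.
have [k k_inj] := countable_injP _ free_interval_countable.
have {}e_inj x y : jump x -> jump y -> e x = e y -> x = y.
  by move=> *; apply: e_inj => //; rewrite inE.
have {}k_inj uv uv' : free_interval uv -> free_interval uv' -> k uv = k uv' ->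
    uv = uv'.
  by move=> *; apply: k_inj => //; rewrite inE.
(* Odd components are allotted to the free intervals, through [k], and even ones
   to the jumps, through [e]. *)
pose component n (c : rat -> L) :=
  [/\ [/\ forall q, exists y, c q < y,
      forall q, jump (c q) -> [/\ ~~ odd n, q = 0%R & e (c q) = n./2] &
      forall j, jump j -> ~~ odd n -> e j = n./2 -> c 0%R = j],
      forall q q' : rat, ~ jump (c q) -> (q < q')%R -> c q < c q',
      forall x, dense_unbounded [set q | c q < x],
      ~~ odd n -> forall x, zero < x -> exists q, c q < x &
      forall uv, free_interval uv -> odd n -> k uv = n./2 ->
        exists q, uv.1 < c q /\ c q < uv.2].
(* The default for components to which neither a jump nor a free interval is allotted. *)
have [g0 g0P] : exists g, interval_component [set: rat] zero b g.
  apply: (interval_component_exists D_countable D_dense) => //.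
    exact: dense_unbounded_rat.
  by exists 0%R.
have g0_ok n : (forall j, jump j -> ~~ odd n -> e j = n./2 -> False) ->
    (forall uv, free_interval uv -> odd n -> k uv = n./2 -> False) ->
    component n g0.
  move=> noj nok; have [g0y g0j g0M g0du] := interval_component_schedule bj g0P.
  split=> [|q q' _|//|_ x x0|uv uvP no kn]; [|exact: g0M| |by case: (nok uv)].
    by split=> // [q /g0j//|j jj ne ej]; case: (noj j).
  have [_ _ g0dense] := g0P.
  have [||q [_ _ qx]] := g0dense zero (Order.min x b) (lexx _).
  - by rewrite lt_min x0 b0.
  - by rewrite ge_min lexx orbT.
  by exists q; move: qx; rewrite lt_min => /andP[].
have /choice[c cP] n : exists c, component n c.
  have [no|ne] := boolP (odd n).
    have [[uv uvP kn]|nok] := pselect (exists2 uv, free_interval uv & k uv = n./2).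
      have [_ _ uv1 uvj] := uvP; have [g gP] := free_interval_component uvP.
      have [gy gj gM gdu] := interval_component_schedule uvj gP.
      have [_ _ gdense] := gP.
      exists g; split=> [|q q' _|//||uv' uvP' _ kn']; [|exact: gM| |].
      - by split=> // [q /gj//|j _]; rewrite no.
      - by rewrite no.
      rewrite (k_inj uv' uv) ?kn //.
      by have [q [_ ? ?]] := gdense _ _ (lexx _) uv1 (lexx _); exists q.
    exists g0; apply: g0_ok => [j _|uv uvP _ kn]; first by rewrite no.
    by apply: nok; exists uv.
  have [[j jj ej]|noj] := pselect (exists2 j, jump j & e j = n./2); last first.
    exists g0; apply: g0_ok => [j jj _ ej|uv uvP]; last by rewrite (negbTE ne).
    by apply: noj; exists j.
  have [c [c0 cj cM cdu cz]] := punctured_component b0 bj jj.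
  exists c; split=> [|q q' nj|//|//|uv _]; last by rewrite (negbTE ne).
  - split=> [q|q|j' jj' _ ej'].
    + have [->|/cj[y cy _]] := eqVneq q 0%R; last by exists y.
      by rewrite c0; have [y [jy _]] := jj; exists y.
    + by have [->|/cj[]//] := eqVneq q 0%R; rewrite c0.
    + by rewrite c0; apply: e_inj => //; rewrite ej'.
  - by apply: cM; apply/eqP => q0; apply: nj; rewrite q0 c0.
exists (fun p => c p.1 p.2); split=> /=.
- by move=> [n q]; have [[cy _ _] _ _ _ _] := cP n.
- move=> x xj; exists ((e x).*2, 0%R); have [[_ _ cj] _ _ _ _] := cP (e x).*2.
  by apply: cj; rewrite ?odd_double ?doubleK.
- move=> [n q] [n' q'] /= nj eqc; have [[_ cj _] _ _ _ _] := cP n.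
  have [[_ cj' _] _ _ _ _] := cP n'.
  (* A point taking a jump is determined by it: the component is even with half index given by [e],
     and the rational is [0]. *)
  have [ne q0 en] := cj q nj; have [|ne' q0' en'] := cj' q'; first by rewrite -eqc.
  rewrite [in LHS]q0 q0'; congr pair.
  by rewrite -(even_halfK ne) -(even_halfK ne') -en -en' eqc.
- by move=> n q q'; have [_ cM _ _ _] := cP n; apply: cM.
- move=> x y xy xyj; have [uv uvP [xu vy]] := free_interval_between xy xyj.
  have [_ _ _ _ /(_ uv uvP)] := cP (k uv).*2.+1.
  rewrite /= odd_double /= uphalf_double => -[//|//|q [uq qv]].
  exists ((k uv).*2.+1, q) => /=; first exact: ltW (lt_trans xu uq).
  exact: lt_trans qv vy.
- move=> x y n xy; have [_ _ _ cz _] := cP n.*2.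
  have [||q cq] := cz _ y; first by rewrite odd_double.
    by apply: le_lt_trans xy; apply: (zero_least.2 x I).
  by exists (n.*2, q) => //=; rewrite -addnn leq_addr.
- by move=> n x; have [_ _ cdu _ _] := cP n.
Qed.

(** The positive elements of [D] are countable and come arbitrarily close to [zero]; enumerate them
    as [a] and choose each [z n] below both [a n] and the preceding jump. *)
Lemma vanishing_jumps :
  (forall x, zero < x -> ~ jump_free zero x) ->
  exists z : nat -> L, [/\ injective z, forall m, jump (z m) &
    forall x, zero < x -> exists N, forall m, (N <= m)%N -> z m < x].
Proof.
move=> nofree; have [[y0 zy0] zero_nj] := zero_non_isolated.
(* The jump found in [[zero, x)] is not [zero], which has no immediate successor. *)
have small_jump x : zero < x -> exists j, [/\ jump j, zero < j & j < x].
  move=> x0; apply: contrapT => noj; apply: (nofree x x0) => j zj jx jj.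
  apply: noj; exists j; split=> //; rewrite lt_def zj andbT.
  by apply/eqP => j0; apply: zero_nj; rewrite j0 in jj.
have D_small x : zero < x -> exists c, [/\ D c, zero < c & c < x].
  by move=> /small_jump[j [_ zj jx]]; apply: D_dense zj jx.
have D0_countable : countable [set c | D c /\ zero < c].
  by apply: sub_countable D_countable; apply: subset_card_le => c [].
have D0_nonempty : [set c | D c /\ zero < c] !=set0.
  by have [c [Dc zc _]] := D_small _ zy0; exists c.
have [a [aD a_onto]] := countable_enumeration D0_countable D0_nonempty.
have /choice[F FP] (p : nat * L) : exists j, zero < p.2 ->
    [/\ jump j, zero < j, j < p.2 & j < a p.1].
  have [z2|nz2] := pselect (zero < p.2); last by exists zero => /nz2.
  have [|j [jj zj]] := small_jump (Order.min p.2 (a p.1)).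
    by rewrite lt_min z2; have [] := aD p.1.
  by rewrite lt_min => /andP[jp ja]; exists j.
pose z := fix z n := if n is k.+1 then F (k.+1, z k) else F (0, y0).
have z_pos n : zero < z n.
  by elim: n => [|n IH] /=; [have [] := FP (0, y0) zy0|have [] := FP (n.+1, z n) IH].
have zP n : jump (z n) /\ z n < a n.
  case: n => [|n] /=; first by have [] := FP (0, y0) zy0.
  by have [] := FP (n.+1, z n) (z_pos n).
have zS n : z n.+1 < z n by have [] := FP (n.+1, z n) (z_pos n).
have z_anti m n : (m < n)%N -> z n < z m.
  elim: n => // n IH; rewrite ltnS leq_eqVlt => /predU1P[->//|/IH].
  exact: lt_trans (zS n).
exists z; split=> [m n zmn|m|x x0].
- by case: (ltngtP m n) => // /z_anti; rewrite zmn ltxx.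
- by have [] := zP m.
- have [c [Dc zc cx]] := D_small x x0; have [|N aN] := a_onto c; first by [].
  exists N => m; rewrite leq_eqVlt => /predU1P[<-|/z_anti zmN].
    by apply: lt_trans cx; rewrite -aN; have [] := zP N.
  by apply: lt_trans cx; apply: lt_trans zmN _; rewrite -aN; have [] := zP N.
Qed.

(* Outside the components reserved for free intervals, the points receive
   jumps tending to [zero], so that every stage is cofinite in those
   components; the remaining jumps are taken by the points [(2 i, 0)]. *)
Lemma schedule_of_vanishing_jumps :
  (forall x, zero < x -> ~ jump_free zero x) ->
  exists s : Bomega -> L, schedule s.
Proof.
move=> /vanishing_jumps[z [z_inj z_jump z_small]].
have [k k_inj] := countable_injP _ free_interval_countable.
have {}k_inj uv uv' : free_interval uv -> free_interval uv' -> k uv = k uv' ->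
    uv = uv'.
  by move=> *; apply: k_inj => //; rewrite inE.
pose reserved n := `[< odd n /\ exists2 uv, free_interval uv & k uv = n./2 >].
pose vanishing (p : Bomega) := ~~ reserved p.1 && (odd p.1 || (p.2 != 0%R)).
(* Only odd indices of [z] are spent here; the even ones keep the set [W] of remaining jumps
   infinite, so that it can be matched with all the points [(2 i, 0)]. *)
pose zp (p : Bomega) := z (pickle p).*2.+1.
have zp_inj : injective zp.
  move=> p p' /z_inj[] /(can_inj doubleK).
  exact: (pcan_inj pickleK).
(* The exceptions are among the points with code below [N]. *)
have zp_small x : zero < x -> exists t : seq Bomega, forall p, p \notin t -> zp p < x.
  move=> /z_small[N zN]; exists (pmap unpickle (iota 0 N)) => p pt.
  apply: zN; rewrite leqNgt; apply/negP => pN; case/negP: pt.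
  rewrite mem_pmap; apply/mapP; exists (pickle p); last by rewrite pickleK.
  rewrite mem_iota /= add0n; apply: leq_ltn_trans (ltnW pN).
  by rewrite -addnn leq_addr.
pose W := [set x | jump x /\ forall p, vanishing p -> zp p <> x].
have W_inf : infinite_set W.
  have z2W : [set z m.*2 | m in [set: nat]] `<=` W.
    move=> _ [m _ <-]; split=> // p _ /z_inj/(congr1 odd).
    by rewrite /= !odd_double.
  apply: (sub_infinite_set z2W); apply/infiniteP.
  rewrite -(card_le_eqr (card_esym (inj_card_eq _))) // => m n _ _.
  by move=> /z_inj/(can_inj doubleK).
have W_countable : countable W.
  by apply: sub_countable jump_countable; apply: subset_card_le => x [].
have [w [wW w_inj w_onto]] := infinite_countable_bijection W_countable W_inf.
have {}w_inj : injective w by move=> i j; apply: w_inj; rewrite inE.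
have /choice[g gP] n : exists g : rat -> L, reserved n ->
    [/\ [/\ forall q, exists y, g q < y, forall q, ~ jump (g q),
        forall q q' : rat, (q < q')%R -> g q < g q' &
        forall x, dense_unbounded [set q | g q < x]] &
      forall uv, free_interval uv -> k uv = n./2 ->
        exists q, uv.1 < g q /\ g q < uv.2].
  have [/asboolP[no [uv uvP kn]]|_] := boolP (reserved n); last first.
    by exists (fun=> zero).
  have [_ _ uv1 uvj] := uvP; have [g gP] := free_interval_component uvP.
  exists g => _; split; first exact: interval_component_schedule uvj gP.
  move=> uv' uvP' kn'; rewrite (k_inj uv' uv) ?kn //.
  have [_ _ gdense] := gP.
  by have [q [_ ? ?]] := gdense _ _ (lexx _) uv1 (lexx _); exists q.
pose s (p : Bomega) := if reserved p.1 then g p.1 p.2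
  else if vanishing p then zp p else w p.1./2.
have s_res n q : reserved n -> s (n, q) = g n q by rewrite /s /= => ->.
have s_van p : vanishing p -> s p = zp p.
  by rewrite /s => vp; rewrite vp; move: vp => /andP[/negbTE-> _].
have s_oth p : ~~ reserved p.1 -> ~~ vanishing p ->
    [/\ s p = w p.1./2, ~~ odd p.1 & p.2 = 0%R].
  rewrite /s => /[dup] np /negbTE-> /[dup] + /negbTE->.
  by rewrite /vanishing np /= negb_or negbK => /andP[? /eqP].
have s_jump p : ~~ reserved p.1 -> jump (s p).
  move=> np; have [/s_van->|/(s_oth _ np)[-> _ _]] := boolP (vanishing p).
    exact: z_jump.
  by have [] := wW p.1./2 I.
have even_unreserved i : ~~ reserved i.*2.
  by apply/asboolP; rewrite odd_double => -[].
have s_cofinite n x : zero < x -> ~~ reserved n ->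
    exists t : seq rat, forall q, q \notin t -> s (n, q) < x.
  move=> /zp_small[t tP] nr; exists (0%R :: [seq p.2 | p <- t]) => q.
  rewrite inE negb_or => /andP[q0 qt]; rewrite s_van.
    by apply: tP; apply/negP => nqt; case/negP: qt; apply/mapP; exists (n, q).
  by rewrite /vanishing /= nr q0 orbT.
exists s; split.
- move=> [n q]; have [nr|/(s_jump (n, q))[y [qy _]]] := boolP (reserved n).
    by rewrite s_res //; have [[gy _ _ _] _] := gP n nr.
  by exists y.
- move=> x xj; have [[p vp <-]|nop] := pselect (exists2 p, vanishing p & zp p = x).
    by exists p; apply: s_van.
  have [|i _ <-] := w_onto x.
    by split=> // p vp px; apply: nop; exists p.
  exists (i.*2, 0%R); have [||-> _ _] := s_oth (i.*2, 0%R).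
  + exact: even_unreserved.
  + by rewrite /vanishing /= odd_double andbF.
  + by rewrite /= doubleK.
- have jump_unreserved p : jump (s p) -> ~~ reserved p.1.
    move: p => [n q]; apply: contraPN => /= nr; rewrite s_res //.
    by have [[_ gj _ _] _] := gP n nr.
  move=> p p' pj pp'; have p'j : jump (s p') by rewrite -pp'.
  move: pp' (jump_unreserved _ pj) (jump_unreserved _ p'j) => + np np'.
  have [vp|nvp] := boolP (vanishing p); have [vp'|nvp'] := boolP (vanishing p').
  + by rewrite !s_van // => /zp_inj.
  + rewrite s_van //; have [-> _ _] := s_oth _ np' nvp' => zw.
    by have [_ /(_ p vp zw)] := wW p'.1./2 I.
  + rewrite (s_van p') //; have [-> _ _] := s_oth _ np nvp => wz.
    by have [_ /(_ p' vp' (esym wz))] := wW p.1./2 I.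
  + have [-> ne q0] := s_oth _ np nvp; have [-> ne' q0'] := s_oth _ np' nvp'.
    move=> /w_inj nn; rewrite [p]surjective_pairing [p']surjective_pairing.
    by rewrite q0 q0' -(even_halfK ne) -(even_halfK ne') nn.
(* Only reserved components have times that are not jumps. *)
- move=> n q q' nj; have [nr|/(s_jump (n, q))//] := boolP (reserved n).
  by rewrite !s_res //; have [[_ _ gM _] _] := gP n nr; apply: gM.
- move=> x y xy xyj; have [uv uvP [xu vy]] := free_interval_between xy xyj.
  have kE : (k uv).*2.+1./2 = k uv by rewrite /= uphalf_double.
  have nr : reserved (k uv).*2.+1.
    by apply/asboolP; split; [rewrite /= odd_double|exists uv].
  have [_ /(_ uv uvP)] := gP _ nr; rewrite kE => -[//|q [uq qv]].
  exists ((k uv).*2.+1, q); rewrite s_res //; first exact: ltW (lt_trans xu uq).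
  exact: lt_trans qv vy.
- move=> x y n xy; have y0 : zero < y.
    by apply: le_lt_trans xy; apply: (zero_least.2 x I).
  have [t tP] := s_cofinite n.*2 y y0 (even_unreserved n).
  have [q [qt _ _]] := @rat_avoid t 0%R 1%R isT.
  by exists (n.*2, q); [exact: tP|rewrite /= -addnn leq_addr].
- move=> n x; have [nr|nr] := boolP (reserved n).
    rewrite (_ : [set q | s (n, q) < x] = [set q | g n q < x]).
      by have [[_ _ _ gdu] _] := gP n nr.
    by apply/seteqP; split=> q /=; rewrite s_res.
  have [x0|x0] := leP x zero.
    have -> : [set q | s (n, q) < x] = set0.
      apply/seteqP; split=> // q /= qx.
      by have := lt_le_trans qx x0; rewrite ltNge (zero_least.2 _ I).
    by split.
  have [t tP] := s_cofinite n x x0 nr.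
  exact: cofinite_dense_unbounded tP.
Qed.

Lemma schedule_exists : exists s : Bomega -> L, schedule s.
Proof.
have [[b b0 bj]|nofree] := pselect (exists2 b, zero < b & jump_free zero b).
  exact: schedule_of_free_interval b0 bj.
apply: schedule_of_vanishing_jumps => x x0 xj.
by apply: nofree; exists x.
Qed.

End ScheduleExists.

Theorem theorem5p2 (R : realType) (d : Order.disp_t) (L : orderType d)
    (zero : L)
    (L_embeddable : embeddable_in L R)
    (L_complete : complete_order L)
    (zero_least : is_least [set: L] zero)
    (zero_non_isolated : non_isolated zero) :
  exists C : set (set Bomega),
    maximal_chain_in (copies Bomega_lt `|` [set set0]) C /\
    order_isomorphic C (fun A B => A `<` B) [set: L] (fun x y => x < y).
Proof.
have [D [D_countable D_dense]] := embeddable_countable_dense L_embeddable.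
have [s s_schedule] := schedule_exists zero_least zero_non_isolated
  (embeddable_countable_jump L_embeddable) D_countable D_dense.
exact (schedule_chain L_complete zero_least s_schedule).
Qed.
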